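(* Let $K$ be a field of characteristic $p>0$. There exists a cyclic non-holonomic non-Noetherian $\mathcal D(P_n)$-module $M$ such that $\mathrm{Dim}(M)=n$.
   Context: $P_n=K[x_1,\dots,x_n]$, $n\ge1$; $\mathcal D(P_n)$ is the ring of $K$-linear differential operators on $P_n$; modules are left modules. For $j\ge0$, $\partial_i^{[j]}=\frac{\partial_i^j}{j!}$ is the operator $x^\alpha\mapsto\binom{\alpha_i}{j}x^{\alpha-je_i}$ (zero if $j>\alpha_i$), $\partial^{[\beta]}=\prod_i\partial_i^{[\beta_i]}$. $\mathcal D(P_n)=\bigoplus_{\alpha,\beta\in\mathbb N^n}Kx^\alpha\partial^{[\beta]}$; canonical filtration $F_i=\bigoplus_{|\alpha|+|\beta|\le i}Kx^\alpha\partial^{[\beta]}$. For $f:\mathbb N\to\mathbb N$, $\gamma(f):=\inf\{r\ge0:f(i)\le i^r\text{ for }i\gg0\}$. For a finitely generated module $M=\mathcal D(P_n)M_0$ ($\dim_KM_0<\infty$), $\mathrm{Dim}(M):=\gamma(i\mapsto\dim_KF_iM_0)$; a nonzero such $M$ is holonomic if there is a polynomial $q\in\mathbb Q[t]$ of degree $n$ with $\dim_K(F_iM_0)\le q(i)$ for $i\gg0$. Both notions are independent of $M_0$. *)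

(* Defs.v *)
From HB Require Import structures.
From mathcomp Require Import all_boot all_order all_algebra.
(* mpoly has to be imported before the files of mathcomp-analysis: in the other
   order their notations clash. *)
From mathcomp Require Import ssrcomplements mpoly bigenough.
From mathcomp Require Import boolp classical_sets filter reals ereal topology.
From mathcomp Require Import normedtype sequences exp.

Set Implicit Arguments.
Unset Strict Implicit.
Unset Printing Implicit Defensive.

Import Order.TTheory GRing.Theory Num.Theory BigEnough.

Local Open Scope classical_set_scope.
Local Open Scope ring_scope.

Section LinearAlgebra.
Context {A : pzRingType} {V : lmodType A}.

Definition lspan (S : set V) : set V :=
  [set v | exists (k : nat) (c : 'I_k -> A) (s : 'I_k -> V),
    (forall i, S (s i)) /\ v = \sum_(i < k) c i *: s i].

Definition lfree (d : nat) (e : 'I_d -> V) : Prop :=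
  forall c : 'I_d -> A, \sum_(i < d) c i *: e i = 0 -> forall i, c i = 0.

Definition has_ldim (W : set V) (d : nat) : Prop :=
  exists e : 'I_d -> V, lfree e /\ lspan (range e) = W.

End LinearAlgebra.

Definition fin_ldim (K : fieldType) (V : lmodType K) (W : set V) : Prop :=
  exists d, has_ldim W d.

(* Only meaningful for finite-dimensional subspaces; otherwise the default 0. *)
Definition ldim (K : fieldType) (V : lmodType K) (W : set V) : nat :=
  xget 0%N [set d | has_ldim W d].

Record pend (n : nat) (K : fieldType) :=
  PEnd { pend_fun :> {mpoly K[n]} -> {mpoly K[n]}; pend_lin : linear pend_fun }.

HB.instance Definition _ n K := gen_eqMixin (pend n K).
HB.instance Definition _ n K := gen_choiceMixin (pend n K).

Section EndoAlgebra.
Context (n : nat) (K : fieldType).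
Implicit Types (u v w : pend n K) (c d : K).

HB.instance Definition _ u :=
  GRing.isLinear.Build K {mpoly K[n]} {mpoly K[n]} _ (pend_fun u) (pend_lin u).

Lemma pendP u v : u =1 v -> u = v.
Proof.
case: u v => [f fl] [g gl] /= /funext fg; subst g.
by congr PEnd; exact: Prop_irrelevance.
Qed.

Definition pend_zero : pend n K.
Proof. by exists (fun=> 0) => c f g; rewrite scaler0 addr0. Defined.

Definition pend_opp u : pend n K.
Proof. by exists (fun f => - u f) => c f g; rewrite linearP opprD scalerN. Defined.

Definition pend_add u v : pend n K.
Proof.
by exists (fun f => u f + v f) => c f g; rewrite !linearP scalerDr addrACA.
Defined.

Definition pend_one : pend n K.
Proof. by exists (fun f => f). Defined.

Definition pend_mul u v : pend n K.
Proof. by exists (fun f => u (v f)) => c f g; rewrite !linearP. Defined.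

Definition pend_scale c u : pend n K.
Proof.
by exists (fun f => c *: u f) => d f g; rewrite linearP scalerDr !scalerA mulrC.
Defined.

Fact pend_addA : associative pend_add.
Proof. by move=> u v w; apply: pendP => f /=; rewrite addrA. Qed.
Fact pend_addC : commutative pend_add.
Proof. by move=> u v; apply: pendP => f /=; rewrite addrC. Qed.
Fact pend_add0 : left_id pend_zero pend_add.
Proof. by move=> u; apply: pendP => f /=; rewrite add0r. Qed.
Fact pend_addN : left_inverse pend_zero pend_opp pend_add.
Proof. by move=> u; apply: pendP => f /=; rewrite addNr. Qed.

HB.instance Definition _ := GRing.isZmodule.Build (pend n K)
  pend_addA pend_addC pend_add0 pend_addN.

Fact pend_mulA : associative pend_mul.
Proof. by move=> u v w; apply: pendP. Qed.
Fact pend_mul1 : left_id pend_one pend_mul.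
Proof. by move=> u; apply: pendP. Qed.
Fact pend_mulr1 : right_id pend_one pend_mul.
Proof. by move=> u; apply: pendP. Qed.
Fact pend_mulDl : left_distributive pend_mul +%R.
Proof. by move=> u v w; apply: pendP. Qed.
Fact pend_mulDr : right_distributive pend_mul +%R.
Proof. by move=> u v w; apply: pendP => f /=; rewrite linearD. Qed.
Fact pend_one_neq0 : pend_one != 0.
Proof.
apply/eqP => /(congr1 (fun u : pend n K => u 1)) /= /eqP.
by rewrite oner_eq0.
Qed.

HB.instance Definition _ := GRing.Zmodule_isNzRing.Build (pend n K)
  pend_mulA pend_mul1 pend_mulr1 pend_mulDl pend_mulDr pend_one_neq0.

Fact pend_scaleA c d u : pend_scale c (pend_scale d u) = pend_scale (c * d) u.
Proof. by apply: pendP => f /=; rewrite scalerA. Qed.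
Fact pend_scale1 : left_id 1 pend_scale.
Proof. by move=> u; apply: pendP => f /=; rewrite scale1r. Qed.
Fact pend_scaleDr : right_distributive pend_scale +%R.
Proof. by move=> c u v; apply: pendP => f /=; rewrite scalerDr. Qed.
Fact pend_scaleDl u : {morph pend_scale^~ u : c d / c + d}.
Proof. by move=> c d; apply: pendP => f /=; rewrite scalerDl. Qed.

HB.instance Definition _ := GRing.Zmodule_isLmodule.Build K (pend n K)
  pend_scaleA pend_scale1 pend_scaleDr pend_scaleDl.

Fact pend_scaleAl c u v : c *: (u * v) = (c *: u) * v.
Proof. by apply: pendP. Qed.
HB.instance Definition _ :=
  GRing.Lmodule_isLalgebra.Build K (pend n K) pend_scaleAl.

Fact pend_scaleAr c u v : c *: (u * v) = u * (c *: v).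
Proof. by apply: pendP => f /=; rewrite -[RHS]/(u (c *: v f)) linearZ. Qed.
HB.instance Definition _ :=
  GRing.Lalgebra_isAlgebra.Build K (pend n K) pend_scaleAr.

End EndoAlgebra.

Section DiffOp.
Context (n : nat) (K : fieldType).
Implicit Types (u v : pend n K) (f g : {mpoly K[n]}).

Definition pmul f : pend n K.
Proof. by exists (fun g => f * g) => c g h; rewrite mulrDr scalerAr. Defined.

Definition comm_pend u v : pend n K := u * v - v * u.

(* Grothendieck's filtration by order: D_(-1) = 0 and u is in D_k
   iff [u, f] is in D_(k-1) for all f in P_n. *)
Fixpoint diffop_le (k : nat) (u : pend n K) : Prop :=
  if k is k'.+1 then forall f, diffop_le k' (comm_pend u (pmul f))
  else forall f, comm_pend u (pmul f) = 0.

Definition is_diffop : {pred pend n K} := [pred u | `[< exists k, diffop_le k u >]].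

Fact comm_pend_lin c u v w :
  comm_pend (c *: u + v) w = c *: comm_pend u w + comm_pend v w.
Proof.
rewrite /comm_pend mulrDl mulrDr -scalerAl -scalerAr scalerBr opprD.
by rewrite addrACA.
Qed.

Fact comm_pendM u v w :
  comm_pend (u * v) w = u * comm_pend v w + comm_pend u w * v.
Proof. by rewrite /comm_pend mulrBr mulrBl !mulrA addrA subrK. Qed.

Fact diffop_le_lin k c u v :
  diffop_le k u -> diffop_le k v -> diffop_le k (c *: u + v).
Proof.
elim: k u v => [|k IHk] u v /= du dv f; rewrite comm_pend_lin.
  by rewrite du dv scaler0 addr0.
exact: IHk.
Qed.

Fact diffop_le0 k : diffop_le k 0.
Proof.
by elim: k => [|k IHk] /= f; rewrite /comm_pend mul0r mulr0 subr0.
Qed.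

Fact diffop_leS k u : diffop_le k u -> diffop_le k.+1 u.
Proof.
elim: k u => [|k IHk] u /= du f; last by apply: IHk.
by rewrite du => g; rewrite /comm_pend mul0r mulr0 subr0.
Qed.

Fact diffop_leW k l u : (k <= l)%N -> diffop_le k u -> diffop_le l u.
Proof.
move=> /subnK <-; elim: (l - k)%N => // m IHm du.
by rewrite addSn; apply/diffop_leS/IHm.
Qed.

Fact diffop_leD k u v : diffop_le k u -> diffop_le k v -> diffop_le k (u + v).
Proof. by move=> du dv; rewrite -[u]scale1r; apply: diffop_le_lin. Qed.

Fact diffop_leM k l u v :
  diffop_le k u -> diffop_le l v -> diffop_le (k + l) (u * v).
Proof.
have [m] := ubnP (k + l); elim: m => // m IHm in k l u v *.
rewrite ltnS => lem du dv.
have HL f : diffop_le (k + l).-1 (u * comm_pend v (pmul f)).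
  case: l => [|l] in lem dv *; first by rewrite dv mulr0; exact: diffop_le0.
  by rewrite addnS /=; apply: IHm => //; rewrite -addnS.
have HR f : diffop_le (k + l).-1 (comm_pend u (pmul f) * v).
  case: k => [|k] in lem du {HL} *; first by rewrite du mul0r; exact: diffop_le0.
  by rewrite addSn /=; apply: IHm => //; rewrite -addSn.
case: k l lem du dv HL HR => [|k] [|l] lem du dv HL HR.
- by rewrite addn0 /= => f; rewrite comm_pendM du dv mulr0 mul0r addr0.
- by move=> /= f; rewrite comm_pendM; apply: diffop_leD; [exact: HL|exact: HR].
- by move=> /= f; rewrite comm_pendM; apply: diffop_leD; [exact: HL|exact: HR].
- by move=> /= f; rewrite comm_pendM; apply: diffop_leD; [exact: HL|exact: HR].
Qed.

Fact is_diffop_subalg : subalg_closed is_diffop.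
Proof.
split.
- apply/asboolP; exists 0%N => f; rewrite /comm_pend mul1r mulr1.
  exact: subrr.
- move=> c u v /asboolP[k du] /asboolP[l dv]; apply/asboolP.
  exists (maxn k l); apply: diffop_le_lin.
    exact: diffop_leW (leq_maxl k l) du.
  exact: diffop_leW (leq_maxr k l) dv.
- move=> u v /asboolP[k du] /asboolP[l dv]; apply/asboolP.
  by exists (k + l)%N; exact: diffop_leM.
Qed.

HB.instance Definition _ :=
  GRing.isSubalgClosed.Build K (pend n K) is_diffop is_diffop_subalg.

Record diffop := DiffOp { diffop_val :> pend n K; _ : diffop_val \in is_diffop }.

HB.instance Definition _ := [isSub for diffop_val].
HB.instance Definition _ := [Choice of diffop by <:].
HB.instance Definition _ := [SubChoice_isSubAlgebra of diffop by <:].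

(* The operator d_i^[j] = d_i^j / j!, i.e. the linear extension of x^a |-> 'C(a_i, j) x^(a - j e_i). *)
Definition divpow_fun (i : 'I_n) (j : nat) f : {mpoly K[n]} :=
  \sum_(a <- msupp f) ('C(a i, j)%:R * f@_a) *: 'X_[a - U_(i) *+ j].

Fact divpow_fun_wE i j f k : (msize f <= k)%N ->
  divpow_fun i j f =
  \sum_(a : 'X_{1..n < k}) ('C(a i, j)%:R * f@_a) *: 'X_[a - U_(i) *+ j].
Proof.
pose I : subFinType _ := 'X_{1..n < k}.
move=> le_pk; rewrite /divpow_fun (big_mksub I) /=; first last.
- by move=> x /msize_mdeg_lt/leq_trans/(_ le_pk).
- by rewrite msupp_uniq.
rewrite big_rmcond //= => a /memN_msupp_eq0 ->.
by rewrite mulr0 scale0r.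
Qed.

Fact divpow_fun_lin i j : linear (divpow_fun i j).
Proof.
move=> c f g; pose_big_enough k.
  rewrite !(@divpow_fun_wE _ _ _ k) // scaler_sumr -big_split /=.
  apply: eq_bigr => a _; rewrite scalerA -scalerDl; congr (_ *: _).
  by rewrite mcoeffD mcoeffZ mulrDr mulrCA.
by close.
Qed.

Definition divpow i j : pend n K := PEnd (divpow_fun_lin i j).

Definition mdivpow (b : 'X_{1..n}) : pend n K := \prod_(i < n) divpow i (b i).

(* The generators x^a d^[b] lie in D(P_n), so that this is their K-span. *)
Definition canonF (i : nat) : set diffop :=
  [set u | lspan [set pmul 'X_[ab.1] * mdivpow ab.2
                 | ab in [set ab : 'X_{1..n} * 'X_{1..n}
                         | (mdeg ab.1 + mdeg ab.2 <= i)%N]]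
             (diffop_val u)].

End DiffOp.

Definition restK (n : nat) (K : fieldType) (M : lmodType (diffop n K)) : Type := M.

Section RestrictScalars.
Context (n : nat) (K : fieldType) (M : lmodType (diffop n K)).

HB.instance Definition _ := GRing.Zmodule.on (restK M).

Definition restK_scale (c : K) (m : restK M) : restK M :=
  ((c%:A : diffop n K) *: (m : M)).

Fact restK_scaleA c d m :
  restK_scale c (restK_scale d m) = restK_scale (c * d) m.
Proof. by rewrite /restK_scale scalerA -scalerAl mul1r scalerA. Qed.
Fact restK_scale1 : left_id 1 restK_scale.
Proof. by move=> m; rewrite /restK_scale !scale1r. Qed.
Fact restK_scaleDr : right_distributive restK_scale +%R.
Proof. by move=> c m m'; rewrite /restK_scale scalerDr. Qed.
Fact restK_scaleDl m : {morph restK_scale^~ m : c d / c + d}.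
Proof. by move=> c d; rewrite /restK_scale !scalerDl. Qed.

HB.instance Definition _ := GRing.Zmodule_isLmodule.Build K (restK M)
  restK_scaleA restK_scale1 restK_scaleDr restK_scaleDl.

End RestrictScalars.

Definition cyclic_module (A : pzRingType) (M : lmodType A) : Prop :=
  exists m : M, forall x : M, exists a : A, x = a *: m.

Definition noetherian_module (A : pzRingType) (M : lmodType A) : Prop :=
  forall N : nat -> {pred M},
    (forall k, submod_closed (N k)) ->
    (forall k, {subset N k <= N k.+1}) ->
    exists k, forall l, (k <= l)%N -> N l =i N k.

Section Dimension.
Context (n : nat) (K : fieldType) (M : lmodType (diffop n K)).

Definition generating_subspace (M0 : set (restK M)) : Prop :=
  fin_ldim M0 /\ forall x : M, lspan (M0 : set M) x.

Definition filtM (M0 : set (restK M)) (i : nat) : set (restK M) :=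
  lspan [set ((u *: (m : M)) : restK M) | u in canonF i & m in M0].

Definition holonomic : Prop :=
  (exists x : M, x != 0) /\
  exists M0, generating_subspace M0 /\
    exists q : {poly rat}, size q = n.+1 /\
      \forall i \near \oo, (ldim (filtM M0 i))%:R <= q.[i%:R].

End Dimension.

(* The growth exponent gamma(f), equal to +oo if no power of i bounds f. *)
Definition growth (R : realType) (f : nat -> nat) : \bar R :=
  ereal_inf [set r%:E | r in
    [set r : R | 0 <= r /\ \forall i \near \oo, (f i)%:R <= i%:R `^ r]].

(* The growth exponent does not depend on the generating subspace M0. *)
Definition Dim_is (R : realType) (n : nat) (K : fieldType)
    (M : lmodType (diffop n K)) (d : \bar R) : Prop :=
  (exists M0 : set (restK M), generating_subspace M0) /\
  forall M0 : set (restK M), generating_subspace M0 ->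
    growth R (fun i => ldim (filtM M0 i)) = d.

(* Main.v *)
(* In characteristic p, let m be the sequence of the powers x_1^(p^j), j >= 0, in
   the product of countably many copies of P_n, and let M = D(P_n) m. An operator
   of order < p^j commutes with x_1^(p^j), so M consists of the sequences v that
   are eventually of the form v_j = f x_1^(p^j) with f in P_n. The operator
   d_1^[p^k] maps m to the k-th unit sequence e_k, so M is cyclic and contains the
   direct sum of the P_n e_k, which gives a strictly increasing chain of
   submodules. In F_i m only the e_k with p^k <= i appear, so dim F_i m grows like
   i^n log i: this is not bounded by a polynomial of degree n, but by i^r for
   every r > n. *)
Require Import Defs.
From HB Require Import structures.
From mathcomp Require Import all_boot all_order all_algebra.
From mathcomp Require Import ssrcomplements mpoly bigenough.
From mathcomp Require Import boolp classical_sets filter reals ereal topology.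
From mathcomp Require Import normedtype sequences exp.
From mathcomp Require Import functions.
From mathcomp Require Import zify ring lra.

Set Implicit Arguments.
Unset Strict Implicit.
Unset Printing Implicit Defensive.

Import Order.TTheory GRing.Theory Num.Theory.

Local Open Scope classical_set_scope.
Local Open Scope ring_scope.

(** * Linear algebra *)

Section Span.
Context {A : pzRingType} {V : lmodType A}.

Lemma lspan_ge (S W : set V) : W 0 ->
    (forall c u v, W u -> W v -> W (c *: u + v)) -> S `<=` W ->
  lspan S `<=` W.
Proof.
move=> W0 Wlin SW _ [k [c [s [Ss ->]]]].
elim/big_rec: _ => // i x _ Wx; apply: Wlin => //.
exact/SW/Ss.
Qed.

Lemma lspan_gen (S : set V) : S `<=` lspan S.
Proof.
move=> x Sx; exists 1%N, (fun=> 1), (fun=> x); split=> //.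
by rewrite big_ord1 scale1r.
Qed.

Lemma lspan0 (S : set V) : lspan S 0.
Proof.
by exists 0%N, (fun=> 0), (fun=> 0); split=> [[]//|]; rewrite big_ord0.
Qed.

Lemma lspan_lin (S : set V) c u v :
  lspan S u -> lspan S v -> lspan S (c *: u + v).
Proof.
move=> [k [a [s [Ss ->]]]] [l [b [t [St ->]]]].
exists (k + l)%N.
exists (fun i => match fintype.split i with inl i => c * a i | inr j => b j end).
exists (fun i => match fintype.split i with inl i => s i | inr j => t j end).
split=> [i|]; first by case: fintype.split.
rewrite big_split_ord /= scaler_sumr; congr (_ + _); apply: eq_bigr => i _.
  by rewrite -[lshift _ _]/(unsplit (inl i)) unsplitK scalerA.
by rewrite -[rshift _ _]/(unsplit (inr i)) unsplitK.
Qed.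

Lemma lspan_sum (S : set V) (I : Type) (r : seq I) (P : pred I) c (s : I -> V) :
  (forall i, P i -> S (s i)) -> lspan S (\sum_(i <- r | P i) c i *: s i).
Proof.
move=> Ss; elim/big_rec: _ => [|i x Pi Sx]; first exact: lspan0.
exact: lspan_lin (lspan_gen (Ss i Pi)) Sx.
Qed.

Lemma lspan_rangeP (T : finType) (f : T -> V) v :
  lspan (range f) v -> exists c : T -> A, v = \sum_t c t *: f t.
Proof.
move: v; apply: lspan_ge => [|a _ _ [c ->] [d ->]|_ [t _ <-]].
- by exists (fun=> 0); rewrite big1// => t _; rewrite scale0r.
- exists (fun t => a * c t + d t); rewrite scaler_sumr -big_split/=.
  by apply: eq_bigr => t _; rewrite scalerDl scalerA.
- exists (fun u => (u == t)%:R); rewrite (bigD1 t)//= eqxx scale1r.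
  by rewrite big1 ?addr0// => u /negPf ->; rewrite scale0r.
Qed.

End Span.

Section FieldDimension.
Context {K : fieldType} {V : lmodType K}.
Implicit Types (W : set V).

Definition free_fam (T : finType) (e : T -> V) :=
  forall c : T -> K, \sum_t c t *: e t = 0 -> forall t, c t = 0.

(** If [T] were larger than [T'], the matrix [B] of coefficients of the [e t] over the [f t'] would
    have more rows than columns; a nonzero vector of its left kernel is a nontrivial relation among
    the [e t]. *)
Lemma free_fam_card_le (T T' : finType) (e : T -> V) (f : T' -> V) :
  free_fam e -> (forall t, lspan (range f) (e t)) -> (#|T| <= #|T'|)%N.
Proof.
move=> fe ef.
have /choice[a ae] t : exists c : T' -> K, e t = \sum_t' c t' *: f t'.
  exact/lspan_rangeP.
rewrite leqNgt; apply/negP => lt.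
pose B := \matrix_(i < #|T|, j < #|T'|) a (enum_val i) (enum_val j).
have : kermx B != 0.
  rewrite kermx_eq0 /row_free; apply/negP => /eqP Br.
  by have := rank_leq_col B; rewrite Br leqNgt lt.
case/rowV0Pn => u /sub_kermxP uB; case/rV0Pn => i0 /eqP; apply.
have -> : u 0 i0 = u 0 (enum_rank (enum_val i0)) by rewrite enum_valK.
apply: (fe (fun t => u 0 (enum_rank t))).
under eq_bigr do rewrite ae scaler_sumr.
rewrite exchange_big/= big1// => t' _.
under eq_bigr do rewrite scalerA.
rewrite -scaler_suml.
have /matrixP/(_ 0 (enum_rank t')) := uB; rewrite mxE mxE.
rewrite (reindex enum_rank)/=; last first.
  by exists enum_val => ? _; rewrite ?enum_rankK ?enum_valK.
move=> uB0; rewrite [X in X *: _](_ : _ = 0) ?scale0r// -[RHS]uB0.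
by apply: eq_bigr => t _; rewrite mxE !enum_rankK.
Qed.


Lemma has_ldim_inj W d d' : has_ldim W d -> has_ldim W d' -> d = d'.
Proof.
suff le a b : has_ldim W a -> has_ldim W b -> (a <= b)%N.
  by move=> dW d'W; apply/eqP; rewrite eqn_leq !le.
move=> [e [fe eW]] [f [ff fW]].
rewrite -[a]card_ord -[b]card_ord; apply: (free_fam_card_le (f := f)) fe _ => t.
by rewrite fW -eW; exact: lspan_gen.
Qed.

Lemma ldimE W d : has_ldim W d -> ldim W = d.
Proof.
move=> dW; rewrite /ldim; case: xgetP => [_ -> d'W|/(_ d)//].
exact: has_ldim_inj d'W dW.
Qed.

Section Bounds.
Context (W : set V) (T' : finType) (f : T' -> V).
Hypothesis W0 : W 0.
Hypothesis Wlin : forall c u v, W u -> W v -> W (c *: u + v).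
Hypothesis Wf : W `<=` lspan (range f).

(** Free families in [W] have at most [#|T'|] members, so one of maximal size exists; by maximality
    it spans [W]. *)
Lemma exists_ldim : exists d, has_ldim W d.
Proof.
pose P d := `[< exists (T : finType) (e : T -> V),
  [/\ #|T| = d, free_fam e & forall t, W (e t)] >].
have exP : exists d, P d.
  exists 0%N; apply/asboolP; exists void, (fun=> 0); split=> //.
  by rewrite card_void.
have maxP d : P d -> (d <= #|T'|)%N.
  move=> /asboolP[T [e [<- fe We]]]; apply: (free_fam_card_le (f := f)) fe _ => t.
  exact/Wf/We.
case: (ex_maxnP exP maxP) => d /asboolP[T [e [Td fe We]]] dmax.
exists #|T|, (e \o enum_val); split=> [c c0 i|].
  rewrite -(enum_valK i); apply: (fe (c \o enum_rank)).
  rewrite -[RHS]c0 [RHS](reindex enum_rank)/=; last first.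
    by exists enum_val => ? _; rewrite ?enum_rankK ?enum_valK.
  by apply: eq_bigr => t _; rewrite enum_rankK.
apply/seteqP; split; first by apply: lspan_ge => // _ [i _ <-]; exact: We.
move=> w Ww; apply: contrapT => /= Sw.
suff /dmax : P d.+1 by rewrite ltnn.
apply/asboolP; exists (option T), (fun o => if o is Some t then e t else w).
split; [by rewrite card_option Td| |by case].
move=> c; rewrite (bigD1 None)//= (reindex_omap Some id)/=; last by case.
under eq_bigl do rewrite eqxx.
move=> c0.
(* Otherwise dividing by [c None] would put [w] in the span of [e]. *)
have cN : c None = 0.
  apply: contrapT => /eqP cN; apply: Sw.
  have -> : w = \sum_t (- (c None)^-1 * c (Some t)) *: e t.
    rewrite -[LHS]scale1r -(mulVf cN) -scalerA.
    move/eqP: c0; rewrite addr_eq0 => /eqP ->.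
    rewrite scalerN -scaleNr scaler_sumr; apply: eq_bigr => t _.
    by rewrite scalerA.
  apply: lspan_sum => t _; exists (enum_rank t) => //=.
  by rewrite enum_rankK.
case=> [t|//]; apply: (fe (c \o Some)).
by rewrite -[RHS]c0 cN scale0r add0r.
Qed.

Lemma ldim_le_card : (ldim W <= #|T'|)%N.
Proof.
have [d dW] := exists_ldim; rewrite (ldimE dW).
case: dW => e [fe eW]; rewrite -[d]card_ord.
apply: (free_fam_card_le (f := f)) fe _ => t.
by apply: Wf; rewrite -eW; exact: lspan_gen.
Qed.

Lemma card_le_ldim (T : finType) (e : T -> V) :
  free_fam e -> (forall t, W (e t)) -> (#|T| <= ldim W)%N.
Proof.
move=> fe We; have [d dW] := exists_ldim; rewrite (ldimE dW).
case: dW => g [fg gW]; rewrite -[d]card_ord.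
apply: (free_fam_card_le (f := g)) fe _ => t.
by rewrite gW.
Qed.

End Bounds.
End FieldDimension.

(** * Differential operators *)

Section Operators.
Context (n : nat) (K : fieldType).
Implicit Types (u v w : pend n K) (f g : {mpoly K[n]}) (a b : 'X_{1..n}).

Lemma pendZ u (c : K) f : u (c *: f) = c *: u f.
Proof. exact: linearZ. Qed.

Lemma pend_expand u f : u f = \sum_(a <- msupp f) f@_a *: u 'X_[a].
Proof.
rewrite {1}[f]mpolyE linear_sum.
by apply: eq_bigr => a _; exact: pendZ.
Qed.

Lemma pend_eqX u v : (forall a, u 'X_[a] = v 'X_[a]) -> u = v.
Proof.
move=> uv; apply: pendP => f; rewrite !pend_expand.
by apply: eq_bigr => a _; rewrite uv.
Qed.

Lemma pmulM f g : pmul (f * g) = pmul f * pmul g.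
Proof. by apply: pendP => h /=; rewrite mulrA. Qed.

Lemma pmul_lin (c : K) f g : pmul (c *: f + g) = c *: pmul f + pmul g.
Proof. by apply: pendP => h /=; rewrite mulrDl scalerAl. Qed.

Lemma diffop_le_pmul f : diffop_le 0 (pmul f).
Proof. by move=> g; apply: pendP => h /=; rewrite mulrCA subrr. Qed.

(** * Commutators and the order of divided powers *)

Lemma comm_pmulM u f g : comm_pend u (pmul (f * g)) =
  comm_pend u (pmul f) * pmul g + pmul f * comm_pend u (pmul g).
Proof. by rewrite /comm_pend pmulM mulrBl mulrBr !mulrA addrA subrK. Qed.

Lemma comm_pmul_lin u (c : K) f g : comm_pend u (pmul (c *: f + g)) =
  c *: comm_pend u (pmul f) + comm_pend u (pmul g).
Proof.
rewrite /comm_pend pmul_lin mulrDr mulrDl -scalerAl -scalerAr scalerBr opprD.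
by rewrite addrACA.
Qed.

(** By the Leibniz rule [comm_pmulM], the polynomials [f] whose commutator with [u] has order at
    most [k] are closed under products and linear combinations, so testing the variables is
    enough. *)
Lemma diffop_leS_vars k u :
  (forall i, diffop_le k (comm_pend u (pmul 'X_i))) -> diffop_le k.+1 u.
Proof.
move=> uX f.
have D0 : diffop_le k (comm_pend u (pmul 1)).
  rewrite (_ : comm_pend _ _ = 0); first exact: diffop_le0.
  by apply: pendP => h /=; rewrite !mul1r subrr.
have DM g h : diffop_le k (comm_pend u (pmul g)) ->
    diffop_le k (comm_pend u (pmul h)) -> diffop_le k (comm_pend u (pmul (g * h))).
  move=> ug uh; rewrite comm_pmulM; apply: diffop_leD.
    by rewrite -[k]addn0; apply: diffop_leM => //; exact: diffop_le_pmul.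
  by rewrite -[k]add0n; apply: diffop_leM => //; exact: diffop_le_pmul.
rewrite [f]mpolyE; elim/big_rec: _ => [|a g _ ug].
  rewrite (_ : comm_pend _ _ = 0); first exact: diffop_le0.
  by apply: pendP => h /=; rewrite !mul0r linear0 subrr.
rewrite comm_pmul_lin; apply: diffop_le_lin => //.
rewrite mpolyXE_id; elim/big_rec: _ => // i h _ uh; apply: (DM) => //.
by elim: (a i) => [|m IHm]; rewrite ?expr0// exprS; apply: (DM).
Qed.

Lemma divpowX i j a :
  divpow K i j 'X_[a] = 'C(a i, j)%:R *: 'X_[a - U_(i) *+ j].
Proof. by rewrite /= /divpow_fun msuppX big_seq1 mcoeffX eqxx mulr1. Qed.

(** On monomials this is Pascal's rule C(a + 1, j + 1) - C(a, j + 1) = C(a, j) in the variable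
    [i]. *)
Lemma comm_divpow_var (i k : 'I_n) j : comm_pend (divpow K i j.+1) (pmul 'X_k) =
  if i == k then divpow K i j else 0.
Proof.
apply: pend_eqX => a; rewrite /comm_pend.
rewrite -[LHS]/(divpow K i j.+1 ('X_k * 'X_[a]) - 'X_k * divpow K i j.+1 'X_[a]).
rewrite -mpolyXD !divpowX -scalerAr -mpolyXD mnmDE mnm1E (eq_sym k).
(* The truncated exponents can differ only when [a i <= j], and then the binomial coefficient is
   zero. *)
have XE : ('C(a i, j.+1)%:R : K) *: 'X_[U_(k) + (a - U_(i) *+ j.+1)] =
    ('C(a i, j.+1)%:R : K) *: 'X_[U_(k) + a - U_(i) *+ j.+1] :> {mpoly K[n]}.
  have [lt|le] := ltnP (a i) j.+1; first by rewrite bin_small// !scale0r.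
  congr (_ *: 'X_[_]); apply/mnmP => l; rewrite !(mnmDE, mnmBE, mulmnE, mnm1E).
  case: (eqVneq i l) => [<-|_]; last by lia.
  by rewrite mul1n; lia.
rewrite XE -scalerBl; case: eqVneq => [<-|_].
  rewrite divpowX add1n binS natrD addrAC subrr add0r.
  congr (_ *: 'X_[_]); apply/mnmP => l; rewrite !(mnmDE, mnmBE, mulmnE, mnm1E).
  by lia.
by rewrite add0n subrr scale0r.
Qed.

Lemma diffop_le_divpow (i : 'I_n) j : diffop_le j (divpow K i j).
Proof.
elim: j => [|j IHj].
  have -> : divpow K i 0 = 1.
    apply: pend_eqX => a; rewrite divpowX bin0 scale1r.
    by congr 'X_[_]; apply/mnmP => l; rewrite mnmBE mulmnE muln0 subn0.
  by move=> f; rewrite /comm_pend mul1r mulr1 subrr.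
apply: diffop_leS_vars => k; rewrite comm_divpow_var.
by case: eqP => // _; exact: diffop_le0.
Qed.

Lemma diffop_le_mdivpow b : diffop_le (mdeg b) (mdivpow K b).
Proof.
rewrite mdegE /mdivpow; apply: (big_ind2 (@diffop_le n K)).
- by move=> f; rewrite /comm_pend mul1r mulr1 subrr.
- by move=> k u l v; exact: diffop_leM.
- by move=> i _; exact: diffop_le_divpow.
Qed.

Lemma mdivpowX b a :
  mdivpow K b 'X_[a] = (\prod_(i < n) 'C(a i, b i))%:R *: 'X_[a - b].
Proof.
(* Induction over duplicate-free index lists: each factor still sees the original exponent [a i] of
   its own variable. *)
have XE (r : seq 'I_n) : uniq r ->
    (\prod_(i <- r) divpow K i (b i)) 'X_[a] =
    (\prod_(i <- r) 'C(a i, b i))%:R *: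
      'X_[[multinom a i - (if i \in r then b i else 0) | i < n]].
  elim: r => [_|i r IHr /=/andP[ir /IHr rE]].
    rewrite !big_nil scale1r -[LHS]/'X_[a]; congr 'X_[_].
    by apply/mnmP => l; rewrite mnmE subn0.
  rewrite !big_cons.
  rewrite -[LHS]/(divpow K i (b i) ((\prod_(i <- r) divpow K i (b i)) 'X_[a])).
  rewrite rE pendZ divpowX scalerA -natrM mulnC mnmE (negPf ir) subn0.
  congr (_ *: 'X_[_]); apply/mnmP => l; rewrite !(mnmE, mulmnE, in_cons).
  case: (eqVneq l i) => [->|_]; rewrite ?(negPf ir) ?mnmE/=; last by lia.
  by lia.
rewrite XE ?index_enum_uniq//; congr (_ *: 'X_[_]); apply/mnmP => l.
by rewrite mnmE mnmBE mem_index_enum.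
Qed.

(** A monomial x^a with |a| <= |b| and a <> b has some exponent a_i < b_i, so its binomial factor
    vanishes; only x^b contributes. *)
Lemma mdivpow_top b f : (msize f <= (mdeg b).+1)%N -> mdivpow K b f = (f@_b)%:MP.
Proof.
move=> fb; rewrite pend_expand.
have E a : a \in msupp f ->
    f@_a *: mdivpow K b 'X_[a] = if a == b then (f@_b)%:MP else 0.
  move=> af; have := leq_trans (msize_mdeg_lt af) fb; rewrite ltnS => ab.
  rewrite mdivpowX; case: eqVneq => [->|nab].
    rewrite big1 => [|i _]; last by rewrite binn.
    rewrite scale1r -mul_mpolyC (_ : (b - b)%MM = 0%MM) ?mpolyX0 ?mulr1//.
    by apply/mnmP => i; rewrite mnmBE subnn mnm0E.
  case: (boolP [exists i, (a i < b i)%N]) => [/existsP[i ai]|].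
    by rewrite (bigD1 i)//= bin_small// mul0n scale0r scaler0.
  move=> /existsPn ba; case/eqP: nab; apply/mnmP => i; apply/eqP; rewrite eqn_leq.
  have ba' j : (b j <= a j)%N by rewrite leqNgt ba.
  rewrite ba' andbT leqNgt; apply/negP => lt; move: ab; rewrite leqNgt => /negP; apply.
  rewrite !mdegE (bigD1 i)//= [X in (_ < X)%N](bigD1 i)//= -addSn.
  by apply: leq_add => //; apply: leq_sum.
rewrite big_seq (eq_bigr _ E) -big_seq.
have [bf|bf] := boolP (b \in msupp f).
  rewrite (bigD1_seq b)//= eqxx big1_seq ?addr0// => a /andP[/negPf ->].
  by [].
rewrite memN_msupp_eq0// mpolyC0 big1_seq// => a /andP[_ af].
by case: eqP.
Qed.

Lemma msize_sum_le (I : eqType) (r : seq I) (F : I -> {mpoly K[n]}) k :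
  (forall i, i \in r -> (msize (F i) <= k)%N) -> (msize (\sum_(i <- r) F i) <= k)%N.
Proof.
move=> Fk; rewrite big_seq; elim/big_ind: _ => [|f g fk gk|//]; first by rewrite msize0.
by rewrite (leq_trans (msizeD_le _ _))// geq_max fk.
Qed.

Lemma msize_mdivpow_le b f : (msize (mdivpow K b f) <= msize f)%N.
Proof.
rewrite pend_expand; apply: msize_sum_le => a af.
rewrite mdivpowX scalerA (leq_trans (msizeZ_le _ _))// msizeX.
by rewrite (leq_ltn_trans (mdegB _ _))// msize_mdeg_lt.
Qed.

Lemma msizeMX_le f a : (msize (f * 'X_[a]) <= msize f + mdeg a)%N.
Proof.
rewrite {1}[f]mpolyE mulr_suml; apply: msize_sum_le => b bf.
rewrite -scalerAl -mpolyXD (leq_trans (msizeZ_le _ _))// msizeX mdegD -addSn.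
by rewrite leq_add2r msize_mdeg_lt.
Qed.

Lemma is_diffop_le k u : diffop_le k u -> u \in @is_diffop n K.
Proof. by move=> uk; apply/asboolP; exists k. Qed.

Definition opX a b : diffop n K := DiffOp (rpredM
  (is_diffop_le (diffop_le_pmul 'X_[a])) (is_diffop_le (diffop_le_mdivpow b))).

Lemma opXE a b f : opX a b f = 'X_[a] * mdivpow K b f.
Proof. by []. Qed.

Lemma canonF_opX a b k : (mdeg a + mdeg b <= k)%N -> canonF k (opX a b).
Proof. by move=> abk; apply: lspan_gen; exists (a, b). Qed.

(** Both bounds hold on the generators and pass to linear combinations. The order controls
    commutation with x^(p^j), the size controls dimensions. *)
Lemma canonF_bound k (u : diffop n K) : canonF k u ->
  diffop_le k u /\ forall f, (msize (u f) <= msize f + k)%N.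
Proof.
rewrite /canonF/=; case: u => u /= _; move: u.
apply: lspan_ge => [|c u v [uk us] [vk vs]|_ [[a b] /= abk <-]]; split.
- exact: diffop_le0.
- by move=> f /=; rewrite msize0.
- exact: diffop_le_lin.
- move=> f /=; rewrite (leq_trans (msizeD_le _ _))// geq_max vs andbT.
  by rewrite (leq_trans (msizeZ_le _ _)).
- apply: (@diffop_leW _ _ (0 + mdeg b)); first by lia.
  by apply: diffop_leM; [exact: diffop_le_pmul|exact: diffop_le_mdivpow].
- move=> f /=; rewrite mulrC (leq_trans (msizeMX_le _ _))// leq_add ?msize_mdivpow_le//.
  by lia.
Qed.

(** * Commutation with p^j-th powers *)

Lemma pmul_pascal f m (d : nat -> pend n K) :
  pmul f * (\sum_(t < m.+1) 'C(m, t)%:R *: (pmul (f ^+ (m - t)) * d t)) +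
  \sum_(t < m.+1) 'C(m, t)%:R *: (pmul (f ^+ (m - t)) * d t.+1) =
  \sum_(t < m.+2) 'C(m.+1, t)%:R *: (pmul (f ^+ (m.+1 - t)) * d t).
Proof.
rewrite [RHS]big_ord_recl [in LHS]big_ord_recl !subn0 !bin0 !scale1r mulrDr.
rewrite mulrA -pmulM -exprS -addrA; congr (_ + _).
rewrite [X in _ + X]big_ord_recr [RHS]big_ord_recr /= !subnn !binn addrA; congr (_ + _).
rewrite mulr_sumr -big_split/=; apply: eq_bigr => t _.
rewrite /bump/= !add1n binS natrD scalerDl subSS -scalerAr mulrA -pmulM -exprS.
by congr (_ *: (pmul (f ^+ _) * _) + _); have := ltn_ord t; lia.
Qed.

(** Induction on [m] from u f^(m+1) = f (u f^m) + [u, f] f^m. The second term is the induction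
    hypothesis for [u, f], whence the generality in [u]; [pmul_pascal] recombines the two sums. *)
Lemma comm_pend_expand u f m : u * pmul (f ^+ m) =
  \sum_(t < m.+1) 'C(m, t)%:R *:
    (pmul (f ^+ (m - t)) * iter t (fun v => comm_pend v (pmul f)) u).
Proof.
elim: m u => [|m IHm] u.
  rewrite big_ord1 /= bin0 scale1r expr0.
  by apply: pendP => h /=; rewrite !mul1r.
have -> : u * pmul (f ^+ m.+1) =
    pmul f * (u * pmul (f ^+ m)) + comm_pend u (pmul f) * pmul (f ^+ m).
  by rewrite exprS pmulM /comm_pend mulrBl !mulrA addrC subrK.
rewrite !IHm -pmul_pascal; congr (_ + _).
by apply: eq_bigr => t _; congr (_ *: (_ * _)); exact/esym/iterSr.
Qed.

Lemma iter_comm_diffop_le k u f t :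
  diffop_le k u -> (k < t)%N -> iter t (fun v => comm_pend v (pmul f)) u = 0.
Proof.
have it0 s : iter s (fun v => comm_pend v (pmul f)) 0 = 0 :> pend n K.
  by elim: s => //= s ->; rewrite /comm_pend mul0r mulr0 subrr.
elim: t k u => // t IHt k u uk kt; rewrite iterSr.
by case: k uk kt => [->|k uk kt]; [rewrite it0|apply: (IHt k)].
Qed.

(** From t C(p^j, t) = p^j C(p^j - 1, t - 1): if p did not divide C(p^j, t), then p^j would divide
    t, which is too small. *)
Lemma pchar_bin_eq0 (p j t : nat) : p \in [pchar K] -> (0 < t < p ^ j)%N ->
  ('C(p ^ j, t)%:R : K) = 0.
Proof.
move=> pK /andP[t0 tj]; apply/eqP; rewrite -(dvdn_pcharf pK).
have pP := pcharf_prime pK.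
apply: contraLR tj => pC; rewrite -leqNgt; apply: dvdn_leq => //.
rewrite -(@Gauss_dvdl _ _ 'C(p ^ j, t)); last by rewrite coprimeXl// prime_coprime.
by case: t t0 {pC} => // t _; rewrite -mul_bin_diag dvdn_mulr.
Qed.

(* Commuting u past f^(p^j) produces the t-fold commutators of u with f, with
   coefficient C(p^j, t): it vanishes for 0 < t < p^j, and the commutator itself
   does for t = p^j. *)
Lemma diffop_le_pchar_expM (p j k : nat) u f g :
    p \in [pchar K] -> diffop_le k u -> (k < p ^ j)%N ->
  u (f ^+ (p ^ j) * g) = f ^+ (p ^ j) * u g.
Proof.
move=> pK uk kj; pose q := (p ^ j)%N.
rewrite -[LHS]/((u * pmul (f ^+ q)) g) comm_pend_expand.
rewrite big_ord_recl big1 => [|t _]; first by rewrite addr0 bin0 scale1r subn0.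
rewrite lift0; have := ltn_ord t; rewrite leq_eqVlt => /orP[/eqP tq|tq].
  by rewrite (iter_comm_diffop_le _ uk) ?mulr0 ?scaler0// tq.
by rewrite pchar_bin_eq0// scale0r.
Qed.

End Operators.

(** * The module generated by the sequence of the powers x_1^(p^j) *)

Definition polyseq_mod (n : nat) (K : fieldType) : Type := nat -> {mpoly K[n]}.

Section PolyseqModule.
Context (n : nat) (K : fieldType).

HB.instance Definition _ :=
  GRing.Zmodule.copy (polyseq_mod n K) (nat -> {mpoly K[n]}).

Definition polyseq_scale (u : diffop n K) (v : polyseq_mod n K) : polyseq_mod n K :=
  fun j => u (v j).

Fact polyseq_scaleA u v w :
  polyseq_scale u (polyseq_scale v w) = polyseq_scale (u * v) w.
Proof. by []. Qed.
Fact polyseq_scale1 : left_id 1 polyseq_scale.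
Proof. by []. Qed.
Fact polyseq_scaleDr : right_distributive polyseq_scale +%R.
Proof. by move=> u v w; apply/funext => j; exact: linearD. Qed.
Fact polyseq_scaleDl w : {morph polyseq_scale^~ w : u v / u + v}.
Proof. by []. Qed.

HB.instance Definition _ := GRing.Zmodule_isLmodule.Build (diffop n K)
  (polyseq_mod n K)
  polyseq_scaleA polyseq_scale1 polyseq_scaleDr polyseq_scaleDl.

End PolyseqModule.

Section Counterexample.
Context (n : nat) (K : fieldType) (p : nat) (i0 : 'I_n).
Implicit Types (f g : {mpoly K[n]}) (a b : 'X_{1..n}).

Definition xpow (j : nat) : {mpoly K[n]} := 'X_[U_(i0) *+ p ^ j].

Lemma diffop_le_xpow (pK : p \in [pchar K]) (u : pend n K) k j f :
  diffop_le k u -> (k < p ^ j)%N -> u (f * xpow j) = u f * xpow j.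
Proof.
move=> uk kj; rewrite /xpow -mpolyXn mulrC (diffop_le_pchar_expM _ _ pK uk kj).
exact: mulrC.
Qed.

(* The argument pK only serves to attach to the predicate (hence to the type of
   its elements) the submodule structure, which depends on it. *)
Definition xpow_tail (pK : p \in [pchar K]) : {pred polyseq_mod n K} :=
  [pred v | `[< exists f J, forall j, (J <= j)%N -> v j = f * xpow j >]].

Context (pK : p \in [pchar K]).

Fact xpow_tail_submod : submod_closed (xpow_tail pK).
Proof.
split; first by apply/asboolP; exists 0, 0%N => j _; rewrite mul0r.
move=> u v w /asboolP[f [J fJ]] /asboolP[g [L gL]]; apply/asboolP.
have /asboolP[k uk] := valP u.
(* The summand [k] makes the order of [u] smaller than p^j, since k <= j < p^j. *)
exists (u f + g), (J + L + k)%N => j le.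
rewrite -[LHS]/(u (v j) + w j) fJ ?gL; [|lia..].
rewrite (diffop_le_xpow pK _ uk) ?mulrDl//.
apply: (@leq_ltn_trans j); first by lia.
by rewrite ltn_expl// (prime_gt1 (pcharf_prime pK)).
Qed.

HB.instance Definition _ := GRing.isSubmodClosed.Build (diffop n K)
  (polyseq_mod n K) (xpow_tail pK) xpow_tail_submod.

Record tailmod := TailMod {
  tail_val : polyseq_mod n K; _ : tail_val \in xpow_tail pK }.

HB.instance Definition _ := [isSub for tail_val].
HB.instance Definition _ := [Choice of tailmod by <:].
HB.instance Definition _ := [SubChoice_isSubLmodule of tailmod by <:].

Definition tail_coord (v : tailmod) (j : nat) : {mpoly K[n]} := tail_val v j.
Local Coercion tail_coord : tailmod >-> Funclass.

Lemma tailmodP (v w : tailmod) : (forall j, v j = w j) -> v = w.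
Proof. by move=> vw; apply/val_inj/funext. Qed.

Lemma tail_lin (u : diffop n K) (v w : tailmod) j : (u *: v + w) j = u (v j) + w j.
Proof. by []. Qed.

Lemma restK_lin (c : K) (v w : restK tailmod) j :
  tail_coord (c *: v + w) j = c *: tail_coord v j + tail_coord w j.
Proof. by []. Qed.

Fact tail_mk_subproof f J (h : nat -> {mpoly K[n]}) :
  (fun j => if (j < J)%N then h j else f * xpow j) \in xpow_tail pK.
Proof. by apply/asboolP; exists f, J => j; rewrite ltnNge => ->. Qed.

Definition tail_mk f J h : tailmod := TailMod (tail_mk_subproof f J h).

Definition tail_gen : tailmod := tail_mk 1 0 (fun=> 0).

Lemma tail_genE j : tail_gen j = xpow j.
Proof. by rewrite -[LHS]/(1 * xpow j) mul1r. Qed.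

Lemma tail_ex (v : tailmod) : exists f J, forall j, (J <= j)%N -> v j = f * xpow j.
Proof. by case: v => v /= /asboolP. Qed.

Lemma msize_xpow j : msize (xpow j) = (p ^ j).+1.
Proof. by rewrite msizeX mdegMn mdeg1 mul1n. Qed.

Lemma ltn_exp_p j : (j < p ^ j)%N.
Proof. by rewrite ltn_expl// (prime_gt1 (pcharf_prime pK)). Qed.

Lemma leq_exp_p j k : (j <= k)%N -> (p ^ j <= p ^ k)%N.
Proof. by rewrite leq_exp2l// (prime_gt1 (pcharf_prime pK)). Qed.

Lemma ltn_exp_pS j k : (j < k)%N -> (p ^ j * 2 <= p ^ k)%N.
Proof.
move=> /leq_exp_p; apply: leq_trans.
by rewrite expnSr leq_mul2l (prime_gt1 (pcharf_prime pK)) orbT.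
Qed.

Lemma msize_mul_xpow_le f j : (msize (f * xpow j) <= msize f + p ^ j)%N.
Proof. by rewrite (leq_trans (msizeMX_le _ _))// mdegMn mdeg1 mul1n. Qed.

(* With b = mlead f + p^k e_i0, the operator d^[b] kills v_j for j < k because
   its degree is less than |b|, and for j > k because d^[b] commutes with
   x^(p^j) and kills f; for j = k it picks the coefficient of x^b. *)
Lemma tail_isolate (v : tailmod) f J k a j : f != 0 ->
    (forall j, (J <= j)%N -> v j = f * xpow j) -> (J <= k)%N ->
    (mdeg (mlead f) < p ^ k)%N ->
    (forall j, (j < J)%N -> (msize (v j) <= p ^ k)%N) ->
  (opX K a (mlead f + U_(i0) *+ p ^ k) *: v) j =
  if j == k then mleadc f *: 'X_[a] else 0.
Proof.
move=> f0 fJ Jk fk vk; set b := (mlead f + _)%MM.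
have fb : mdeg b = (mdeg (mlead f) + p ^ k)%N by rewrite mdegD mdegMn mdeg1 mul1n.
rewrite -[LHS]/(opX K a b (v j)) opXE.
have sf := mlead_deg f0.
have small g : (msize g <= mdeg b)%N -> mdivpow K b g = 0.
  move=> gb; rewrite mdivpow_top; last by rewrite (leq_trans gb).
  by rewrite memN_msupp_eq0 ?mpolyC0// msize_mdeg_ge.
case: eqVneq => [->|jk].
  rewrite fJ// mdivpow_top; last first.
    by rewrite (leq_trans (msize_mul_xpow_le _ _))// -sf fb addSn.
  by rewrite /b addmC mcoeffMX mulrC mul_mpolyC.
have [jJ|Jj] := ltnP j J.
  by rewrite small ?mulr0// (leq_trans (vk _ jJ))// fb leq_addl.
have [jltk|] := ltnP j k; first rewrite small ?mulr0// fJ//.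
  rewrite (leq_trans (msize_mul_xpow_le _ _))// -sf fb.
  by have := ltn_exp_pS jltk; have := ltn_exp_p j; lia.
rewrite leq_eqVlt eq_sym (negPf jk)/= => kltj.
(* The order deg f + p^k of d^[b] is below 2 p^k, which is at most p^j as j > k. *)
rewrite fJ// (diffop_le_xpow pK _ (diffop_le_mdivpow _ b)); last first.
  by rewrite fb (leq_trans _ (ltn_exp_pS kltj))//; lia.
by rewrite small ?mul0r ?mulr0// -sf fb; lia.
Qed.

Lemma tail_gen_isolate k j :
  (opX K 0 (U_(i0) *+ p ^ k) *: tail_gen) j = if j == k then 1 else 0.
Proof.
have pk0 : (0 < p ^ k)%N by rewrite (leq_trans _ (ltn_exp_p k)).
have := @tail_isolate tail_gen 1 0 k 0%MM j (oner_neq0 _).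
rewrite mleadc1 mlead1 add0m scale1r mpolyX0 mdeg0.
exact.
Qed.

Definition opP f : diffop n K := DiffOp (is_diffop_le (diffop_le_pmul f)).

(** Multiplying [tail_gen] by [f] reproduces [v] from [J] on; the finitely many earlier errors [h k]
    are corrected by multiples of the unit sequences. *)
Lemma tail_gen_cyclic (v : tailmod) : exists u : diffop n K, v = u *: tail_gen.
Proof.
have [f [J fJ]] := tail_ex v.
pose h j := v j - f * xpow j.
exists (opP f + \sum_(k < J) opP (h k) * opX K 0 (U_(i0) *+ p ^ k)).
rewrite scalerDl scaler_suml; apply: tailmodP => j.
rewrite -[RHS]/(f * tail_gen j + tail_coord (\sum_(k < J) _) j).
have -> : tail_coord
      (\sum_(k < J) (opP (h k) * opX K 0 (U_(i0) *+ p ^ k)) *: tail_gen) j =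
    \sum_(k < J) (if j == k then h k else 0).
  elim/big_ind2: _ => [//|x1 x2 y1 y2 <- <- //|k _].
  rewrite -scalerA -[LHS]/(h k * (opX K 0 (U_(i0) *+ p ^ k) *: tail_gen) j).
  by rewrite tail_gen_isolate; case: eqP; rewrite ?mulr1 ?mulr0.
rewrite tail_genE; have [jJ|Jj] := ltnP j J.
  rewrite (bigD1 (Ordinal jJ))//= eqxx big1 ?addr0 ?/h; last first.
    by move=> k; rewrite -val_eqE/= eq_sym => /negPf ->.
  by rewrite addrC subrK.
rewrite big1 ?addr0 ?fJ// => k _; case: eqP => // jk.
by have := ltn_ord k; rewrite -jk ltnNge Jj.
Qed.

Lemma tailmod_not_noetherian : ~ noetherian_module tailmod.
Proof.
(* The sequences vanishing from [k] on; the k-th unit sequence lies in [N k.+1] but not in [N k]. *)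
pose N k : {pred tailmod} := [pred v : tailmod | `[< forall j, (k <= j)%N -> v j = 0 >]].
move=> /(_ N)[k|k v|k Nk].
- split; first by apply/asboolP.
  move=> u v w /asboolP v0 /asboolP w0; apply/asboolP => j kj.
  by rewrite tail_lin v0// w0// linear0 addr0.
- by move=> /asboolP v0; apply/asboolP => j kj; apply: v0; exact: ltnW.
have := Nk k.+1 (leqnSn k) (opX K 0 (U_(i0) *+ p ^ k) *: tail_gen).
have -> : opX K 0 (U_(i0) *+ p ^ k) *: tail_gen \in N k.+1.
  by apply/asboolP => j kj; rewrite tail_gen_isolate gtn_eqF.
move=> /esym/asboolP/(_ k (leqnn k)); rewrite tail_gen_isolate eqxx.
by apply/eqP; rewrite oner_eq0.
Qed.

(** * Finite-dimensional pieces of the module *)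

Definition tail_bounded J D : set (restK tailmod) := [set v | exists f,
  [/\ (msize f <= D)%N, forall j, (J <= j)%N -> tail_coord v j = f * xpow j
    & forall j, (msize (tail_coord v j) <= D + p ^ j)%N]].

Lemma tail_bounded0 J D : tail_bounded J D 0.
Proof.
by exists 0; split=> [|j _|j]; rewrite ?mul0r// msize0.
Qed.

Lemma tail_bounded_lin J D c u v :
  tail_bounded J D u -> tail_bounded J D v -> tail_bounded J D (c *: u + v).
Proof.
move=> [f [fD fJ uD]] [g [gD gJ vD]]; exists (c *: f + g).
have le (h k : {mpoly K[n]}) d :
    (msize h <= d)%N -> (msize k <= d)%N -> (msize (c *: h + k) <= d)%N.
  move=> hd kd; rewrite (leq_trans (msizeD_le _ _))// geq_max kd andbT.
  by rewrite (leq_trans (msizeZ_le _ _)).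
split=> [|j Jj|j]; [exact: le| |by rewrite restK_lin; exact: le].
by rewrite restK_lin fJ// gJ// mulrDl scalerAl.
Qed.

Lemma tail_bounded_mono J J' D D' : (J <= J')%N -> (D <= D')%N ->
  tail_bounded J D `<=` tail_bounded J' D'.
Proof.
move=> JJ DD v [f [fD fJ vD]]; exists f; split=> [|j J'j|j].
- exact: leq_trans DD.
- by apply: fJ; exact: leq_trans J'j.
- by rewrite (leq_trans (vD j))// leq_add2r.
Qed.

Lemma tail_bounded_ex (v : tailmod) : exists J D, tail_bounded J D v.
Proof.
have [f [J fJ]] := tail_ex v.
exists J, (msize f + \sum_(j < J) msize (v j))%N, f; split=> // [|j].
  exact: leq_addr.
have [jJ|Jj] := ltnP j J.
  rewrite (bigD1 (Ordinal jJ))//= -addnA addnCA -addnA.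
  exact: leq_addr.
by rewrite fJ// (leq_trans (msize_mul_xpow_le _ _))// leq_add2r leq_addr.
Qed.

(** The size bound for [u] turns [D] into [D + i]. Since the order of [u] is at most [i < p ^ J'],
    the tail keeps its form from [J'] on, with [f] replaced by [u f]. *)
Lemma tail_bounded_act i (u : diffop n K) J J' D v :
    canonF i u -> (J <= J')%N -> (i < p ^ J')%N ->
  tail_bounded J D v -> tail_bounded J' (D + i) (u *: (v : tailmod)).
Proof.
move=> /canonF_bound[ui us] JJ iJ [f [fD fJ vD]]; exists (u f); split=> [|j Jj|j].
- by rewrite (leq_trans (us f))// leq_add2r.
- rewrite -[LHS]/(u (tail_coord v j)) fJ ?(leq_trans JJ)//.
  by rewrite (diffop_le_xpow pK _ ui)// (leq_trans iJ)// leq_exp_p.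
- rewrite -[tail_coord _ _]/(u (tail_coord v j)) (leq_trans (us _))//.
  by rewrite addnAC leq_add2r.
Qed.

(** A box of exponents rather than a simplex of degrees: its cardinality is exactly [E ^ n], of the
    same order of growth. *)
Definition box_mnm E (a : {ffun 'I_n -> 'I_E}) : 'X_{1..n} :=
  [multinom a i : nat | i < n].

Lemma box_mnm_inj E : injective (@box_mnm E).
Proof.
move=> a b /mnmP ab; apply/ffunP => i; apply: val_inj.
by have := ab i; rewrite !mnmE.
Qed.

Lemma box_expand E f : (msize f <= E)%N ->
  f = \sum_(a : {ffun 'I_n -> 'I_E}) f@_(box_mnm a) *: 'X_[box_mnm a].
Proof.
move=> fE; apply/mpolyP => m; rewrite raddf_sum/=.
under eq_bigr do rewrite mcoeffZ mcoeffX.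
have [mf|mf] := boolP (m \in msupp f); last first.
  rewrite memN_msupp_eq0// big1// => a _; case: eqP => [->|_]; last by rewrite mulr0.
  by rewrite memN_msupp_eq0// mul0r.
have mE i : (m i < E)%N.
  rewrite (leq_trans _ fE)// (leq_trans _ (msize_mdeg_lt mf))// ltnS mdegE.
  by rewrite (bigD1 i)//= leq_addr.
rewrite (bigD1 [ffun i => Ordinal (mE i)])//=.
have am : box_mnm [ffun i => Ordinal (mE i)] = m.
  by apply/mnmP => i; rewrite mnmE ffunE.
rewrite am eqxx mulr1 big1 ?addr0// => a na; case: eqP => [bm|_]; last by rewrite mulr0.
by case/eqP: na; apply: (@box_mnm_inj E); rewrite am.
Qed.

(** For [al.2 < J] a monomial placed at the single position [al.2]; for [al.2 = J] a monomial times
    x^(p^j) at all positions j >= J. *)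
Definition tail_fam J E (al : {ffun 'I_n -> 'I_E} * 'I_J.+1) : restK tailmod :=
  tail_mk (if (al.2 == J :> nat) then 'X_[box_mnm al.1] else 0) J
    (fun j => if j == al.2 then 'X_[box_mnm al.1] else 0).

Lemma restK_sum (I : Type) (r : seq I) (P : pred I) (c : I -> K)
    (s : I -> restK tailmod) j :
  tail_coord (\sum_(i <- r | P i) c i *: s i) j =
  \sum_(i <- r | P i) c i *: tail_coord (s i) j.
Proof. by elim/big_rec2: _ => // i x y _ <-; rewrite restK_lin. Qed.

Lemma tail_bounded_span J D :
  tail_bounded J D `<=` lspan (range (@tail_fam J (D + p ^ J))).
Proof.
move=> v [f [fD fJ vD]].
pose g (l : nat) := if (l < J)%N then tail_coord v l else f.
have -> : v = \sum_(al : {ffun 'I_n -> 'I_(D + p ^ J)} * 'I_J.+1)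
    (g al.2)@_(box_mnm al.1) *: tail_fam al; last first.
  by apply: lspan_sum => al _; exists al.
apply: tailmodP => j; rewrite restK_sum.
rewrite -(pair_bigA _ (fun (a : {ffun 'I_n -> 'I_(D + p ^ J)}) (l : 'I_J.+1) =>
  (g l)@_(box_mnm a) *: tail_coord (tail_fam (a, l)) j))/=.
(* Position [j] sees only the family members of index min(j, J), up to the factor [m]. *)
pose l0 : 'I_J.+1 := inord (minn j J).
have l0E : l0 = minn j J :> nat by rewrite inordK// ltnS geq_minr.
pose m : {mpoly K[n]} := if (j < J)%N then 1 else xpow j.
have famE (a : {ffun 'I_n -> 'I_(D + p ^ J)}) (l : 'I_J.+1) :
    tail_coord (@tail_fam J (D + p ^ J) (a, l)) j =
    if l == l0 then 'X_[box_mnm a] * m else 0.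
  rewrite -[LHS]/(if (j < J)%N then _ else _) -val_eqE/= l0E /m.
  case: ltnP => [jJ|Jj].
    by rewrite mulr1 eq_sym.
  by rewrite eq_sym; case: eqP; rewrite ?mul0r.
have inner (a : {ffun 'I_n -> 'I_(D + p ^ J)}) :
    \sum_(l < J.+1) (g l)@_(box_mnm a) *: tail_coord (tail_fam (a, l)) j =
    (g l0)@_(box_mnm a) *: 'X_[box_mnm a] * m.
  rewrite (bigD1 l0)// famE eqxx scalerAl big1 => [|l /negPf ll0].
    exact: addr0.
  by rewrite famE ll0 scaler0.
transitivity (\sum_(a : {ffun 'I_n -> 'I_(D + p ^ J)})
    (g l0)@_(box_mnm a) *: 'X_[box_mnm a] * m); last first.
  by apply: eq_bigr => a _; exact/esym/inner.
rewrite -mulr_suml -box_expand.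
  rewrite /g /m l0E; case: (ltnP j J) => [jJ|Jj].
    by rewrite jJ mulr1.
  by rewrite ltnn fJ.
rewrite /g; case: ltnP => [l0J|_]; last by rewrite (leq_trans fD)// leq_addr.
by rewrite (leq_trans (vD _))// leq_add2l leq_exp_p// ltnW.
Qed.

(** * Bounds for the dimension of the filtration *)

Section Generating.
Context (M0 : set (restK tailmod)) (genM0 : generating_subspace M0).

Lemma filtM_bounded : exists J D, forall i J', (J <= J')%N -> (i < p ^ J')%N ->
  filtM M0 i `<=` tail_bounded J' (D + i).
Proof.
case: genM0 => -[d [e [_ eM0]]] _.
have /choice[J /choice[D bD]] t : exists J D, tail_bounded J D (e t).
  exact: tail_bounded_ex.
(* Sums serve as common upper bounds over the basis [e] of [M0]. *)
exists (\sum_t J t)%N, (\sum_t D t)%N => i J' JJ iJ.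
apply: lspan_ge => [|c u v|_ [u ui [m mM0 <-]]].
- exact: tail_bounded0.
- exact: tail_bounded_lin.
apply: (tail_bounded_act ui JJ iJ).
move: m mM0; rewrite -eM0; apply: lspan_ge => [|c v w|_ [t _ <-]].
- exact: tail_bounded0.
- exact: tail_bounded_lin.
by apply: tail_bounded_mono (bD t); rewrite (bigD1 t)//= leq_addr.
Qed.

Lemma ldim_filtM_le : exists J D, forall i J', (J <= J')%N -> (i < p ^ J')%N ->
  (ldim (filtM M0 i) <= (D + i + p ^ J') ^ n * J'.+1)%N.
Proof.
have [J [D bJD]] := filtM_bounded; exists J, D => i J' JJ iJ.
have le := subset_trans (bJD i J' JJ iJ) (@tail_bounded_span _ _).
have := ldim_le_card (lspan0 _) (@lspan_lin _ _ _) le.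
by rewrite card_prod card_ffun !card_ord.
Qed.

(** The eventually zero sequences form a submodule that misses [tail_gen], so it cannot contain the
    generating set [M0]. *)
Lemma exists_nonzero_tail : exists (v : tailmod) f J,
  [/\ M0 v, f != 0 & forall j, (J <= j)%N -> v j = f * xpow j].
Proof.
apply: contrapT => noex.
pose Z : set tailmod := [set v | exists J, forall j, (J <= j)%N -> v j = 0].
have /(_ tail_gen (genM0.2 tail_gen))[J /(_ J (leqnn J))/eqP] :
    lspan (M0 : set tailmod) `<=` Z.
  apply: lspan_ge => [|u v w [J vJ] [L wL]|v vM0].
  - by exists 0%N.
  - by exists (J + L)%N => j le; rewrite tail_lin vJ ?wL ?linear0 ?addr0//; lia.
  - have [f [J fJ]] := tail_ex v; exists J => j Jj; rewrite fJ//.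
    have [->|f0] := eqVneq f 0; first by rewrite mul0r.
    by case: noex; exists v, f, J.
by rewrite tail_genE -msize_poly_eq0 msize_xpow.
Qed.

(** By [tail_isolate], suitable operators send one [v] in [M0] to nonzero multiples of x^a e_(k0+l),
    for a in a box of side t + 1 and l < L. These are independent, and the hypothesis on [i] puts
    the operators in F_i. *)
Lemma ldim_filtM_ge : exists k0 B, forall L i t,
    (n * t + B + p ^ (k0 + L) <= i)%N ->
  (t.+1 ^ n * L <= ldim (filtM M0 i))%N.
Proof.
have [v [f [J [vM0 f0 fJ]]]] := exists_nonzero_tail.
(* Large enough for every [k0 + l] to satisfy the conditions of [tail_isolate] on [k]. *)
pose k0 := (J + mdeg (mlead f) + \sum_(j < J) msize (v j))%N.
exists k0, (mdeg (mlead f)) => L i t iB.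
(* The upper bound enters only to make [filtM M0 i] finite-dimensional, so that [ldim] is not its
   default value. *)
have [J1 [D bJD]] := filtM_bounded.
have Jle : (J1 <= J1 + i)%N by exact: leq_addr.
have ilt : (i < p ^ (J1 + i))%N by rewrite (leq_trans (ltn_exp_p _))// leq_exp_p// leq_addl.
have Wf := subset_trans (bJD i _ Jle ilt) (@tail_bounded_span _ _).
pose e (al : {ffun 'I_n -> 'I_t.+1} * 'I_L) : restK tailmod :=
  opX K (box_mnm al.1) (mlead f + U_(i0) *+ p ^ (k0 + al.2)) *: v.
have eE (a : {ffun 'I_n -> 'I_t.+1}) (l : 'I_L) j : tail_coord (e (a, l)) j =
    if j == (k0 + l)%N then mleadc f *: 'X_[box_mnm a] else 0.
  have le : (k0 <= p ^ (k0 + l))%N.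
    by rewrite (leq_trans (leq_addr l k0))// ltnW// ltn_exp_p.
  apply: (tail_isolate (J := J)) => // [|/=|j' j'J].
  - by rewrite /= /k0; lia.
  - by rewrite (leq_trans _ (ltn_exp_p _))// /k0; lia.
  - by apply: leq_trans le; rewrite /k0 (bigD1 (Ordinal j'J))//=; lia.
have := card_le_ldim (lspan0 _) (@lspan_lin _ _ _) Wf (e := e).
rewrite card_prod card_ffun !card_ord; apply.
- move=> c c0 [a l].
  (* The coefficient of x^a at position k0 + l singles out the member [(a, l)]. *)
  have E al : (tail_coord (e al) (k0 + l))@_(box_mnm a) =
      if al == (a, l) then mleadc f else 0.
    case: al => a' l'; rewrite eE eqn_add2l xpair_eqE (inj_eq val_inj) andbC eq_sym.
    case: eqP => _; last by rewrite mcoeff0.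
    rewrite mcoeffZ mcoeffX (inj_eq (@box_mnm_inj _)).
    by case: eqP => _; rewrite ?mulr1 ?mulr0.
  have : \sum_al c al * (tail_coord (e al) (k0 + l))@_(box_mnm a) = 0.
    have := congr1 (fun v : restK tailmod => (tail_coord v (k0 + l))@_(box_mnm a)) c0.
    rewrite restK_sum raddf_sum => S0; transitivity ((0 : {mpoly K[n]})@_(box_mnm a)).
      by rewrite -[RHS]S0; apply: eq_bigr => al _; exact/esym/mcoeffZ.
    exact: mcoeff0.
  rewrite (bigD1 (a, l))// E eqxx big1 => [/=|al /negPf ne]; last by rewrite E ne mulr0.
  by rewrite addr0 => /eqP; rewrite mulf_eq0 mleadc_eq0 (negPf f0) orbF => /eqP.
- move=> [a l]; apply: lspan_gen; 
  exists (opX K (box_mnm a) (mlead f + U_(i0) *+ p ^ (k0 + l))).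
    apply: canonF_opX; apply: leq_trans iB.
    rewrite mdegD mdegMn mdeg1 mul1n addnA; apply: leq_add; last first.
      by rewrite leq_exp_p// leq_add2l ltnW.
    rewrite leq_add2r mdegE (@leq_trans (\sum_(i < n) t))//.
      by apply: leq_sum => j _; rewrite mnmE -ltnS.
    by rewrite sum_nat_const card_ord.
  by exists v.
Qed.

End Generating.

End Counterexample.

(** * Growth *)

Lemma poly_rat_le (n : nat) (q : {poly rat}) : size q = n.+1 ->
  exists C : nat, forall i : nat, (0 < i)%N -> q.[i%:R] <= (C * i ^ n)%:R.
Proof.
move=> sq; pose S := \sum_(j < n.+1) `|q`_j|.
exists (Num.bound S) => i i0; rewrite natrM.
have S0 : 0 <= S by apply: sumr_ge0.
apply: (@le_trans _ _ (S * (i ^ n)%:R)); last first.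
  by rewrite ler_wpM2r// ltW// archi_boundP.
rewrite horner_coef sq mulr_suml; apply: ler_sum => j _.
rewrite (le_trans (ler_norm _))// normrM ler_wpM2l// ger0_norm ?exprn_ge0//.
by rewrite -natrX ler_nat leq_pexp2l// -ltnS.
Qed.

Section Growth.
Context (R : realType) (n p : nat) (h : nat -> nat).

Hypothesis n_gt0 : (0 < n)%N.
Hypothesis p_gt1 : (1 < p)%N.
(* Choosing p^J' and p^(k0 + L) close to i, [h_le] and [h_ge] squeeze [h i] between
   multiples of i^n log i. *)
Hypothesis h_le : exists J D, forall i J', (J <= J')%N -> (i < p ^ J')%N ->
  (h i <= (D + i + p ^ J') ^ n * J'.+1)%N.
Hypothesis h_ge : exists k0 B, forall L i t,
  (n * t + B + p ^ (k0 + L) <= i)%N -> (t.+1 ^ n * L <= h i)%N.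

(** A fixed [L] already gives h(i) >= L (t + 1)^n with i <= (n + 1) t, which beats C i^n once L > C
    (n + 1)^n. *)
Lemma not_poly_bounded (q : {poly rat}) : size q = n.+1 ->
  ~ \forall i \near \oo, (h i)%:R <= q.[i%:R].
Proof.
move=> /poly_rat_le[C qC] [N _ hN].
have [k0 [B hB]] := h_ge.
pose L := (C * n.+1 ^ n).+1.
(* [N] brings [i] into the range of the assumed bound; the other summands give [i <= n.+1 * t]. *)
pose t := (N + B + p ^ (k0 + L))%N; pose i := (n * t + B + p ^ (k0 + L))%N.
have pL0 : (0 < p ^ (k0 + L))%N by rewrite expn_gt0 ltnW.
have t0 : (0 < t)%N by rewrite /t; lia.
have ti : (t <= i)%N by rewrite /i -addnA (leq_trans (leq_pmull t n_gt0))// leq_addr.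
have it : (i <= n.+1 * t)%N by rewrite /i mulSn /t; lia.
have Ni : (N <= i)%N by rewrite (leq_trans _ ti)// /t -addnA leq_addr.
have := le_trans (hN i Ni) (qC i (leq_trans t0 ti)).
rewrite ler_nat leqNgt => /negP; apply.
apply: leq_trans (hB L i t (leqnn _)).
rewrite (@leq_ltn_trans (C * n.+1 ^ n * t ^ n)%N)//.
  by rewrite -mulnA -expnMn leq_mul2l leq_exp2r ?it ?orbT.
rewrite [ltnRHS]mulnC (@leq_trans (L * t ^ n)%N)//.
  by rewrite /L mulSn -[ltnLHS]add0n ltn_add2r expn_gt0 t0.
by rewrite leq_mul2l leq_exp2r ?leqnSn ?orbT.
Qed.

(** With e = (r - n) / 2 write i^r = i^n i^e i^e: one factor i^e absorbs the constant [Z], the other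
    the logarithm. *)
Lemma eventually_le_powR (r : R) : n%:R < r ->
  \forall i \near \oo, (h i)%:R <= i%:R `^ r.
Proof.
move=> nr; have [J [D hJD]] := h_le.
pose e : R := (r - n%:R) / 2.
have e0 : 0 < e by rewrite /e; lra.
pose A := (D + 1 + p ^ J.+1)%N.
have ln2 : 0 < ln 2 :> R by rewrite ln_gt0// ltr1n.
(* Chosen for [tY]: J + 2 <= (J + 2) y because y >= 1, and t <= ln i / ln 2 <= y / (e ln 2). *)
pose Y : R := J.+2%:R + (e * ln 2)^-1.
pose Z : R := (A ^ n)%:R * Y.
have Y0 : 0 <= Y by rewrite addr_ge0// invr_ge0 mulr_ge0 ?ltW.
have Z0 : 0 <= Z by rewrite mulr_ge0.
(* Beyond this threshold Z <= e ln i <= y, and [i] is positive. *)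
exists (Num.bound (expR (Z / e))).+1 => // i /= iZ.
have i0 : (0 < i)%N by exact: leq_trans iZ.
have i0R : 0 < i%:R :> R by rewrite ltr0n.
(* Taking [J' = J + t.+1] in [h_le] gives i < p^J' <= p^(J+1) i, so D + i + p^J' <= A i. *)
set t := trunc_log p i.
have iJ : (i < p ^ (J + t.+1))%N.
  rewrite (leq_trans (trunc_log_ltn i p_gt1))// leq_exp2l//.
  exact: leq_addl.
have pti : (p ^ t <= i)%N by exact: trunc_logP.
pose y : R := i%:R `^ e.
have yE : e * ln i%:R + 1 <= y.
  rewrite -[y]lnK ?posrE ?powR_gt0// ln_powR addrC.
  exact: expR_ge1Dx.
have ln_ge0 : 0 <= ln i%:R :> R by rewrite ln_ge0// ler1n.
have eln_ge0 : 0 <= e * ln i%:R by rewrite mulr_ge0// ltW.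
have tln : t%:R * ln 2 <= ln i%:R :> R.
  rewrite mulr_natl -lnXn// ler_ln ?posrE ?exprn_gt0// -natrX ler_nat.
  by apply: leq_trans pti; case: (t) => // t'; rewrite leq_exp2r.
have tY : (J + t.+1).+1%:R <= Y * y.
  have -> : (J + t.+1).+1 = (J.+2 + t)%N by rewrite addnS !addSn.
  rewrite natrD mulrDl lerD//.
    by rewrite ler_peMr// (le_trans _ yE)// lerDr.
  have eln2 : 0 < e * ln 2 by exact: mulr_gt0.
  rewrite ler_pdivlMl//; apply: le_trans yE; rewrite ler_wpDr//.
  by rewrite -mulrA (mulrC (ln 2)); apply: ler_wpM2l => //; exact: ltW.
have Zy : Z <= y.
  apply: le_trans yE; rewrite -[leLHS]addr0 lerD// mulrC -ler_pdivrMr//.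
  rewrite -ler_expR lnK ?posrE// ltW// (lt_le_trans (archi_boundP (expR_ge0 _)))//.
  by rewrite ler_nat ltnW.
apply: (@le_trans _ _ ((A * i) ^ n * (J + t.+1).+1)%:R).
  rewrite ler_nat (leq_trans (hJD i (J + t.+1)%N (leq_addr _ _) iJ))//.
  rewrite leq_mul2r leq_exp2r//; apply/orP; right.
  have -> : (p ^ (J + t.+1) = p ^ J.+1 * p ^ t)%N by rewrite -expnD addSnnS.
  by rewrite /A !mulnDl mul1n !leq_add// ?leq_pmulr// leq_mul2l pti orbT.
rewrite natrM expnMn natrM (mulrC (A ^ n)%:R) -mulrA.
have -> : (i%:R `^ r = (i ^ n)%:R * (y * y) :> R).
  have -> : (r = n%:R + (e + e)) by rewrite /e; field.
  by rewrite powRD ?powRD ?lt0r_neq0 ?implybT// natrX powR_mulrn ?ltW.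
rewrite ler_wpM2l//; apply: (@le_trans _ _ (Z * y)).
  by rewrite -mulrA ler_wpM2l.
by rewrite ler_wpM2r// powR_ge0.
Qed.

Lemma growth_eq : growth R h = n%:R%:E.
Proof.
apply/eqP; rewrite eq_le; apply/andP; split.
  apply/lee_addgt0Pr => e e0; rewrite -EFinD.
  apply: ereal_inf_lbound; exists (n%:R + e) => //; split.
    by rewrite addr_ge0// ltW.
  by apply: eventually_le_powR; rewrite ltrDl.
(* An exponent r < n would bound h by i^n, contrary to [not_poly_bounded] for the polynomial X^n. *)
apply: le_ereal_inf_tmp => _ [r [r0 hr] <-]; rewrite lee_fin leNgt; apply/negP => rn.
apply: (@not_poly_bounded 'X^n (size_polyXn _ _)).
case: hr => N _ hN; exists N.+1 => // i /= Ni.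
have := hN i (ltnW Ni); rewrite hornerXn -natrX ler_nat => hi.
have i1 : 1 <= i%:R :> R by rewrite ler1n (leq_trans _ Ni).
rewrite -(ler_nat R) natrX -powR_mulrn ?ler0n//; apply: le_trans hi _.
by apply: ler_powR => //; exact: ltW.
Qed.

End Growth.

(** * The counterexample *)

Theorem proposition9p9 (R : realType) (K : fieldType) (p : nat)
    (charK : p \in [pchar K]) (n : nat) (n_gt0 : (0 < n)%N) :
  exists M : lmodType (diffop n K),
    [/\ cyclic_module M,
        ~ holonomic M,
        ~ noetherian_module M
      & Dim_is M (n%:R%:E : \bar R)].
Proof.
have p1 := prime_gt1 (pcharf_prime charK).
pose i0 := Ordinal n_gt0.
exists (tailmod i0 charK : lmodType (diffop n K)); split.
- by exists (tail_gen i0 charK) => v; exact: tail_gen_cyclic.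
- move=> [_ [M0 [gM0 [q [sq]]]]].
  exact: (not_poly_bounded n_gt0 p1 (ldim_filtM_ge gM0) sq).
- exact: tailmod_not_noetherian.
split; last first.
  move=> M0 gM0; exact: (growth_eq R n_gt0 p1 (ldim_filtM_le gM0) (ldim_filtM_ge gM0)).
(* The line spanned by [tail_gen] is a generating subspace; the entry x_1 of [tail_gen] at position
   0 shows that it has dimension one. *)
pose e (i : 'I_1) : restK (tailmod i0 charK) := tail_gen i0 charK.
exists (lspan (range e)); split.
  exists 1%N, e; split=> // c; rewrite big_ord1 => c0 i; rewrite ord1.
  pose b : 'X_{1..n} := (U_(i0) *+ p ^ 0)%MM.
  have := congr1 (fun v : restK (tailmod i0 charK) => (tail_coord v 0)@_b) c0.
  rewrite -[X in X -> _]/((c ord0 *: tail_coord (tail_gen i0 charK) 0)@_b =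
    (0 : {mpoly K[n]})@_b).
  by rewrite tail_genE mcoeffZ mcoeff0 mcoeffX eqxx mulr1.
move=> x; have [u ->] := tail_gen_cyclic x.
rewrite -[_ *: _]addr0; apply: lspan_lin; last exact: lspan0.
(* The outer span is over [diffop n K], the inner one over [K]. *)
by apply: lspan_gen; apply: lspan_gen; exists ord0.
Qed.
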